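(* Let $G_3$ be the graph with vertex set $\mathbb{Z}^3$ in which $x,y$ are adjacent if and only if $\max_i |x_i-y_i| = 1$, and let $G_3^*$ be the graph with vertex set $\mathbb{Z}^3+\tfrac12 = \{x\in\mathbb{R}^3 : x_i-\tfrac12\in\mathbb{Z} \text{ for } i=1,2,3\}$ with the same adjacency rule. For $n\ge 0$ let $G_3(n)$ be the subgraph of $G_3$ induced on $\{x\in\mathbb{Z}^3 : |x_1+x_2+x_3|\le n\}$ and $G_3^*(n)$ the subgraph of $G_3^*$ induced on $\{x\in\mathbb{Z}^3+\tfrac12 : |x_1+x_2+x_3|\le n\}$. Then: (i) for every integer $n\ge 0$, $kG_3(n)\cong G_3^*(n+\tfrac12)$; (ii) for every $n\in\{\tfrac12,\tfrac32,\tfrac52,\dots\}$, $kG_3^*(n)\cong G_3(n+\tfrac12)$; (iii) consequently, for every integer $n\ge 0$, $k^2G_3(n)\cong G_3(n+1)$; (iv) letting $\mathrm{Hex}:=G_3(0)$ (the hexagonal lattice, i.e. the subgraph of $G_3$ induced on $\{x\in\mathbb{Z}^3: x_1+x_2+x_3=0\}$), for every integer $n\ge 0$ one has $k^n\mathrm{Hex}\cong G_3(n/2)$ if $n$ is even and $k^n\mathrm{Hex}\cong G_3^*(n/2)$ if $n$ is odd.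
   Context: All graphs are simple and possibly infinite. A clique of a graph $G$ is an inclusion-maximal complete subgraph. The clique graph $kG$ has as vertices the cliques of $G$, two distinct cliques being adjacent if they share at least one vertex. $k^n G$ denotes the $n$-fold iterated clique graph ($k^0G=G$). $\cong$ denotes graph isomorphism. *)

(* Defs.v *)
From HB Require Import structures.
From mathcomp Require Import all_boot all_order all_algebra.
From mathcomp Require Import boolp classical_sets reals.

Set Implicit Arguments.
Unset Strict Implicit.
Unset Printing Implicit Defensive.

Import Order.TTheory GRing.Theory Num.Theory.
Local Open Scope classical_set_scope.
Local Open Scope ring_scope.

Record graph := Graph {
  vertex :> Type;
  adj : vertex -> vertex -> Prop;
  adj_irrefl : forall x, ~ adj x x;
  adj_sym : forall x y, adj x y -> adj y x
}.

Definition graph_iso (G H : graph) : Prop :=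
  exists f : G -> H, bijective f /\ forall x y, adj x y <-> adj (f x) (f y).

Notation "G ≅ H" := (graph_iso G H) (at level 70, no associativity).

Section Induced.
Variables (G : graph) (A : set G).

Definition induced_adj (x y : A) : Prop := adj (val x) (val y).

Lemma induced_adj_irrefl x : ~ induced_adj x x.
Proof. exact: adj_irrefl. Qed.

Lemma induced_adj_sym x y : induced_adj x y -> induced_adj y x.
Proof. exact: adj_sym. Qed.

Definition induced : graph := Graph induced_adj_irrefl induced_adj_sym.
End Induced.

Section CliqueGraph.
Variable G : graph.

(* A complete subgraph is identified with its set of vertices. *)
Definition complete (S : set G) : Prop :=
  forall x y, S x -> S y -> x <> y -> adj x y.

Definition is_clique (S : set G) : Prop :=
  complete S /\ forall T : set G, complete T -> S `<=` T -> T `<=` S.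

Definition clique : Type := [set S : set G | is_clique S].

Definition clique_adj (S T : clique) : Prop :=
  S <> T /\ (val S `&` val T) !=set0.

Lemma clique_adj_irrefl S : ~ clique_adj S S.
Proof. by case. Qed.

Lemma clique_adj_sym S T : clique_adj S T -> clique_adj T S.
Proof. by case=> neST ST0; split; [exact: nesym | rewrite setIC]. Qed.

Definition clique_graph : graph := Graph clique_adj_irrefl clique_adj_sym.
End CliqueGraph.

Definition iter_clique_graph (n : nat) (G : graph) : graph :=
  iter n clique_graph G.

Section Lattices.
Variable R : realType.

Definition king_adj (x y : 'rV[R]_3) : Prop :=
  \big[Num.max/0]_(i < 3) `|x 0 i - y 0 i| = 1.

Lemma king_adj_irrefl x : ~ king_adj x x.
Proof.
rewrite /king_adj big1_idem /=; last 2 first.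
- by rewrite maxxx.
- by move=> i _; rewrite subrr normr0.
by move/esym/eqP; rewrite oner_eq0.
Qed.

Lemma king_adj_sym x y : king_adj x y -> king_adj y x.
Proof. by rewrite /king_adj; under eq_bigr do rewrite distrC. Qed.

(* The adjacency rule on all of R^3; only its restrictions to the two
   lattices below are of interest. *)
Definition king_graph : graph := Graph king_adj_irrefl king_adj_sym.

Definition G3 : graph :=
  induced [set x : king_graph | forall i, (x : 'rV[R]_3) 0 i \is a Num.int].

Definition G3star : graph :=
  induced [set x : king_graph |
    forall i, (x : 'rV[R]_3) 0 i - 2^-1 \is a Num.int].

Definition coord_sum (x : 'rV[R]_3) : R := \sum_(i < 3) x 0 i.

Definition G3_slab (r : R) : graph :=
  induced [set x : G3 | `|coord_sum (val x)| <= r].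

Definition G3star_slab (r : R) : graph :=
  induced [set x : G3star | `|coord_sum (val x)| <= r].

Definition Hex : graph := G3_slab 0.
End Lattices.

(* Main.v *)
Require Import Defs.
From mathcomp Require Import all_boot all_order all_algebra.
From mathcomp Require Import boolp classical_sets reals.
From mathcomp Require Import zify ring lra.
Set Implicit Arguments.
Unset Strict Implicit.
Unset Printing Implicit Defensive.

Import Order.TTheory GRing.Theory Num.Theory.
Local Open Scope ring_scope.

(* A set of pairwise adjacent points lies in a unit cube with vertices in the
   lattice, and the centers of these cubes form the other lattice.  A cube is
   recovered from its intersection with a slab as soon as its center lies in
   the slab whose bound is larger by 1/2; a cube centered further out meets the
   slab in at most one point, which also lies in a better cube.  Hence cliques
   correspond to centers in the larger slab, and two of them meet inside the
   original slab exactly when the centers are adjacent.  Translating the slab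
   of bound N/2 by (N/2, N/2, N/2) makes it the set of integer triples with
   coordinate sum in [N, 2N], which treats both lattices at once and turns the
   passage from cubes to centers into N |-> N + 1. *)

(** * Isomorphisms of graphs and of their clique graphs *)

Lemma graph_isoP (G H : graph) (f : G -> H) :
  injective f -> (forall y, exists x, f x = y) ->
  (forall x y, adj x y <-> adj (f x) (f y)) -> G ≅ H.
Proof.
move=> finj fsurj fadj; exists f; split=> //.
have [g fgK] := choice fsurj.
by exists g => // x; apply: finj; rewrite fgK.
Qed.

Lemma graph_iso_sym (G H : graph) : G ≅ H -> H ≅ G.
Proof.
move=> [f [[g fK gK] fadj]]; exists g; split; first by exists f.
by move=> x y; rewrite fadj !gK.
Qed.

Lemma graph_iso_trans (G H K : graph) : G ≅ H -> H ≅ K -> G ≅ K.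
Proof.
move=> [f [fbij fadj]] [g [gbij gadj]]; exists (g \o f).
by split=> [|x y]; [exact: bij_comp | rewrite fadj gadj].
Qed.

Lemma clique_preimage (G H : graph) (f : G -> H) (g : H -> G) (S : set H) :
  cancel f g -> cancel g f -> (forall x y, adj x y <-> adj (f x) (f y)) ->
  is_clique S -> is_clique (f @^-1` S)%classic.
Proof.
move=> fK gK fadj [Sc Smax]; split=> [x y Sx Sy xy|T Tc ST x Tx].
  by apply/fadj/Sc => // /(can_inj fK).
apply: (Smax (g @^-1` T)%classic) => [y z Ty Tz yz|y Sy|]; rewrite /= ?fK //.
- by rewrite -(gK y) -(gK z); apply/fadj/Tc => // /(can_inj gK).
- by apply: ST; rewrite /= gK.
Qed.

Definition mk_clique (G : graph) (S : set G) (h : is_clique S) : clique G :=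
  exist (fun S => S \in [set S | is_clique S]%classic) S (mem_set h).

Lemma clique_graph_iso (G H : graph) :
  G ≅ H -> clique_graph G ≅ clique_graph H.
Proof.
move=> [f [[g fK gK] fadj]]; apply: graph_iso_sym.
have gadj x y : adj x y <-> adj (g x) (g y) by rewrite fadj !gK.
pose F (S : clique H) : clique G :=
  mk_clique (clique_preimage fK gK fadj (set_mem (valP S))).
have Finj : injective F.
  move=> S T /(congr1 val)/= ST; apply: val_inj; apply/funext => y.
  by move: (congr1 (@^~ (g y)) ST); rewrite /preimage /= gK.
apply: (@graph_isoP (clique_graph H) (clique_graph G) F) => // [S|S T].
  exists (mk_clique (clique_preimage gK fK gadj (set_mem (valP S)))).
  by apply: val_inj; apply/funext => x; rewrite /preimage /= fK.
split=> -[ST [x [Sx Tx]]]; split.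
- by move/Finj.
- by exists (g x); rewrite /= gK.
- by move=> eST; apply: ST; rewrite eST.
- by exists (f x).
Qed.

(** * Integer layers and the cubes containing their cliques *)

Definition triple : Type := int * int * int.

Definition close (a b : triple) : bool :=
  [&& `|a.1.1 - b.1.1| <= 1, `|a.1.2 - b.1.2| <= 1 & `|a.2 - b.2| <= 1].

Definition height (a : triple) : int := a.1.1 + a.1.2 + a.2.

Lemma triple_eq (a b : triple) :
  a.1.1 = b.1.1 -> a.1.2 = b.1.2 -> a.2 = b.2 -> a = b.
Proof. by move: a b => [[? ?] ?] [[? ?] ?] /= -> -> ->. Qed.

Section Layer.
Variable N : nat.

(* The triple [a] stands for the point [a - (N/2, N/2, N/2)], so the bounds on
   the height say that the coordinate sum of that point is at most [N/2] in
   absolute value. *)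
Definition layer_vertex : Type :=
  {a : triple | N%:Z <= height a <= N%:Z *+ 2}.

Definition at_pos (a : triple) (h : N%:Z <= height a <= N%:Z *+ 2) :
    layer_vertex :=
  exist (fun a => N%:Z <= height a <= N%:Z *+ 2) a h.

Definition pos (a : layer_vertex) : triple := sval a.

Lemma posP a : N%:Z <= height (pos a) <= N%:Z *+ 2.
Proof. exact: valP a. Qed.

Lemma pos_inj : injective pos.
Proof. exact: val_inj. Qed.

Definition layer_adj (a b : layer_vertex) : Prop :=
  a <> b /\ close (pos a) (pos b).

Lemma layer_adj_irrefl a : ~ layer_adj a a.
Proof. by case. Qed.

Lemma layer_adj_sym a b : layer_adj a b -> layer_adj b a.
Proof.
move=> [ab cab]; split; first exact: nesym.
by move: cab; rewrite /close; lia.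
Qed.

Definition layer : graph := Graph layer_adj_irrefl layer_adj_sym.

Lemma complete_close (S : set layer) x y :
  complete S -> S x -> S y -> close (pos x) (pos y).
Proof.
move=> Sc Sx Sy; have [->|xy] := pselect (x = y); first by rewrite /close; lia.
by have [] := Sc _ _ Sx Sy xy.
Qed.

(* In the encoding of [layer N.+1], [c] stands for the center of this cube. *)
Definition in_cube (c x : triple) : bool :=
  [&& c.1.1 - 1 <= x.1.1 <= c.1.1, c.1.2 - 1 <= x.1.2 <= c.1.2 &
      c.2 - 1 <= x.2 <= c.2].

Definition cube (c : triple) : set layer := [set x | in_cube c (pos x)].

Lemma cube_complete c : complete (cube c).
Proof.
move=> x y; rewrite /cube /in_cube /= => cx cy xy; split=> //.
by rewrite /close; lia.
Qed.

(* Each coordinate takes both of its two values on three vertices of the cube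
   lying in the layer, so these vertices determine the cube. *)
Lemma cube_rigid c d : N.+1%:Z <= height c <= N.+1%:Z *+ 2 ->
  (forall x : layer, cube c x -> close (pos x) d) -> in_cube c d.
Proof.
case: c => [[c1 c2] c3]; rewrite /height /= => hc near.
have vtx e1 e2 e3 : 0 <= e1 <= 1 -> 0 <= e2 <= 1 -> 0 <= e3 <= 1 ->
    N%:Z <= c1 - e1 + (c2 - e2) + (c3 - e3) <= N%:Z *+ 2 ->
    close (c1 - e1, c2 - e2, c3 - e3) d.
  move=> h1 h2 h3 h.
  apply: (near (@at_pos (c1 - e1, c2 - e2, c3 - e3) h)).
  by rewrite /cube /in_cube /=; lia.
(* Lowering one coordinate of [c] lands in the layer, unless [c] has height 2N + 2; then lowering
   two does. *)
have [small|big] := lerP (c1 + c2 + c3) (N%:Z *+ 2 + 1).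
  have := vtx 1 0 0; have := vtx 0 1 0; have := vtx 0 0 1.
  by rewrite /close /in_cube /=; lia.
have := vtx 0 1 1; have := vtx 1 0 1; have := vtx 1 1 0.
by rewrite /close /in_cube /=; lia.
Qed.

Lemma cube_clique c : N.+1%:Z <= height c <= N.+1%:Z *+ 2 -> is_clique (cube c).
Proof.
move=> hc; split; first exact: cube_complete.
move=> T Tc cT y Ty; apply: cube_rigid hc _ => x /cT Tx.
exact: complete_close Tc Tx Ty.
Qed.

Lemma layer_inhabited : exists x : layer, True.
Proof.
have h : N%:Z <= height (N%:Z, 0, 0) <= N%:Z *+ 2 by rewrite /height /=; lia.
by exists (at_pos h).
Qed.

Lemma clique_neq0 (S : set layer) : is_clique S -> exists x, S x.
Proof.
move=> [Sc Smax]; apply: contrapT => S0; have [x _] := layer_inhabited.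
apply: (S0); exists x; apply: (Smax [set x]%classic) => // [y z -> ->|y Sy] //.
by case: S0; exists y.
Qed.

(** Values of [p] on [S] differ by at most 1, so the largest is [p (pos x0) + 1] or [p (pos x0)].
    The point attaining it later bounds the height of the cube. *)
Lemma complete_max (S : set layer) (p : triple -> int) x0 :
  (forall a b, close a b -> `|p a - p b| <= 1) -> complete S -> S x0 ->
  exists c, (exists2 x, S x & p (pos x) = c) /\
            (forall x, S x -> c - 1 <= p (pos x) <= c).
Proof.
move=> pclose Sc Sx0.
have [[x Sx px]|nomax] := pselect (exists2 x, S x & p (pos x) = p (pos x0) + 1).
  exists (p (pos x)); split; first by exists x.
  move=> y Sy; have := pclose _ _ (complete_close Sc Sx Sy).
  by have := pclose _ _ (complete_close Sc Sx0 Sy); lia.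
exists (p (pos x0)); split; first by exists x0.
move=> y Sy; have := pclose _ _ (complete_close Sc Sx0 Sy).
have : p (pos y) <> p (pos x0) + 1 by move=> py; apply: nomax; exists y.
lia.
Qed.

Lemma complete_sub_cube (S : set layer) x0 : complete S -> S x0 ->
  exists2 c, N.+1%:Z <= height c <= N.+1%:Z *+ 2 & (S `<=` cube c)%classic.
Proof.
move=> Sc Sx0.
have cl1 a b : close a b -> `|a.1.1 - b.1.1| <= 1 by case/and3P.
have cl2 a b : close a b -> `|a.1.2 - b.1.2| <= 1 by case/and3P.
have cl3 a b : close a b -> `|a.2 - b.2| <= 1 by case/and3P.
have [c1 [[x1 Sx1 x1c] S1]] := complete_max cl1 Sc Sx0.
have [c2 [[x2 Sx2 x2c] S2]] := complete_max cl2 Sc Sx0.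
have [c3 [[x3 Sx3 x3c] S3]] := complete_max cl3 Sc Sx0.
have [low|high] := lerP (c1 + c2 + c3) N%:Z.
  (* Then [S] is reduced to the point [(c1, c2, c3)] of height [N]. *)
  exists (c1 + 1, c2, c3) => [|x Sx].
    move: (posP x0) (S1 _ Sx0) (S2 _ Sx0) (S3 _ Sx0).
    by rewrite /height /=; lia.
  move: (posP x) (S1 _ Sx) (S2 _ Sx) (S3 _ Sx).
  by rewrite /cube /in_cube /height /=; lia.
(* A point attaining one maximum is at most 1 below the other two, and its height is at most 2N, so
   [c1 + c2 + c3] is at most 2N + 2. *)
exists (c1, c2, c3) => [|x Sx].
  move: (posP x1) (S1 _ Sx1) (S2 _ Sx1) (S3 _ Sx1).
  move: (posP x2) (S1 _ Sx2) (S2 _ Sx2) (S3 _ Sx2).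
  move: (posP x3) (S1 _ Sx3) (S2 _ Sx3) (S3 _ Sx3).
  by rewrite /height /=; lia.
by move: (S1 _ Sx) (S2 _ Sx) (S3 _ Sx); rewrite /cube /in_cube /=; lia.
Qed.

(** The coordinatewise minimum is the highest lattice point common to both cubes, and its height is
    at least N. If that exceeds 2N, it equals 2N + 1 because [c <> d], and lowering a coordinate on
    which [c] and [d] agree stays in both cubes. *)
Lemma cubes_meet c d :
  N.+1%:Z <= height c <= N.+1%:Z *+ 2 ->
  N.+1%:Z <= height d <= N.+1%:Z *+ 2 ->
  c <> d -> close c d -> (cube c `&` cube d !=set0)%classic.
Proof.
move: c d => [[c1 c2] c3] [[d1 d2] d3]; rewrite /height /close /= => hc hd cd near.
have {}cd : ~ (c1 = d1 /\ c2 = d2 /\ c3 = d3).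
  by move=> [? [? ?]]; apply: cd; congr (_, _, _).
have meet x1 x2 x3 : N%:Z <= x1 + x2 + x3 <= N%:Z *+ 2 ->
    in_cube (c1, c2, c3) (x1, x2, x3) -> in_cube (d1, d2, d3) (x1, x2, x3) ->
    (cube (c1, c2, c3) `&` cube (d1, d2, d3) !=set0)%classic.
  by move=> h hxc hxd; exists (@at_pos (x1, x2, x3) h).
pose m1 := Num.min c1 d1; pose m2 := Num.min c2 d2; pose m3 := Num.min c3 d3.
have [low|high] := lerP (m1 + m2 + m3) (N%:Z *+ 2).
  by apply: (meet m1 m2 m3); rewrite /in_cube /=; lia.
have [e1|ne1] := eqVneq c1 d1.
  by apply: (meet (m1 - 1) m2 m3); rewrite /in_cube /=; lia.
have [e2|ne2] := eqVneq c2 d2.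
  by apply: (meet m1 (m2 - 1) m3); rewrite /in_cube /=; lia.
(* Here [c3 = d3]: if all coordinates differed, the minimum would have height at most 2N. *)
by apply: (meet m1 m2 (m3 - 1)); rewrite /in_cube /=; lia.
Qed.

End Layer.

(** * The clique graph of a layer *)

Lemma clique_graph_layer N : clique_graph (layer N) ≅ layer N.+1.
Proof.
apply: graph_iso_sym.
pose F (c : layer N.+1) : clique (layer N) :=
  mk_clique (cube_clique (posP c)).
have Finj : injective F.
  move=> c d /(congr1 val)/= cd; apply: pos_inj.
  (* All points of [cube (pos f)] are close to [pos f], so rigidity applies; used both ways, it
     makes each corner dominate the other. *)
  have sub (e f : layer N.+1) : @cube N (pos e) = cube (pos f) ->
      in_cube (pos e) (pos f).
    move=> ef; apply: (cube_rigid (posP e)) => x.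
    by rewrite ef /cube /in_cube /close /=; lia.
  move: (sub _ _ cd) (sub _ _ (esym cd)); rewrite /in_cube => h1 h2.
  by apply: triple_eq; lia.
apply: (@graph_isoP (layer N.+1) (clique_graph (layer N)) F) => // [S|c d].
  have Scl := set_mem (valP S); have [x Sx] := clique_neq0 Scl.
  have [c hc Sc] := complete_sub_cube (proj1 Scl) Sx.
  exists (at_pos hc); apply: val_inj => /=; apply/seteqP; split=> //.
  by apply: (proj2 Scl) => //; exact: cube_complete.
split=> [[cd near]|[cd [x [cx dx]]]]; split.
- by move/Finj.
- apply: cubes_meet near; [exact: (posP c)|exact: (posP d)|].
  by move/pos_inj.
- by move=> ecd; apply: cd; rewrite ecd.
- by move: cx dx; rewrite /= /cube /in_cube /close /=; lia.
Qed.

(** * Real slabs as integer layers *)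

Section RealSlab.
Variable R : realType.

(** Both [G3_slab] and [G3star_slab] unfold to this form. *)
Definition slab (A : set (king_graph R)) (r : R) : graph :=
  induced [set x : induced A | `|coord_sum (val x)| <= r]%classic.

Definition real_point (N : nat) (a : triple) : 'rV[R]_3 :=
  \row_i ((tnth [tuple a.1.1; a.1.2; a.2] i)%:~R - N%:R / 2).

Lemma king_adj_real_point N a b :
  king_adj (real_point N a) (real_point N b) <-> a <> b /\ close a b.
Proof.
rewrite /king_adj !big_ord_recl big_ord0 !mxE !(tnth_nth 0) /=.
rewrite !opprB !addrA !subrK -!intrB -!intr_norm.
have maxz (m n : int) : Num.max m%:~R n%:~R = (Num.max m n)%:~R :> R.
  by rewrite /Order.max ltr_int; case: ifP.
rewrite -[0]/(0%:~R : R) !maxz -[X in _ = X]/(1%:~R) /close.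
split=> [/intr_inj abE|[ab near]].
  split; last by lia.
  by move=> ab; move: abE; rewrite ab; lia.
(* An integer maximum that is at most 1 is 1 if positive; otherwise all differences vanish and
   [a = b]. *)
congr _%:~R; have [|le0] := ltrP 0 (Num.max `|a.1.1 - b.1.1|
  (Num.max `|a.1.2 - b.1.2| `|a.2 - b.2|)); first by lia.
by case: ab; apply: triple_eq; lia.
Qed.

Lemma coord_sum_real_point N a :
  coord_sum (real_point N a) = (height a)%:~R - 3 * (N%:R / 2).
Proof.
rewrite /coord_sum !big_ord_recl big_ord0 !mxE !(tnth_nth 0) /= /height !intrD.
by ring.
Qed.

(** The hypothesis covers both lattices: integer points for even [N], half-integer points for odd
    [N]. *)
Lemma slab_layer (A : set (king_graph R)) N :
  (forall x : 'rV[R]_3,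
     A x <-> forall i, x 0 i + N%:R / 2 \is a Num.int) ->
  slab A (N%:R / 2) ≅ layer N.
Proof.
move=> AP; apply: graph_iso_sym.
have Aa a : real_point N a \in A.
  by apply/mem_set/AP => i; rewrite mxE subrK intr_int.
have heightP a : (`|coord_sum (real_point N a)| <= N%:R / 2) =
    (N%:Z <= height a <= N%:Z *+ 2).
  rewrite coord_sum_real_point ler_norml -!(ler_int R) (mulr2n N%:Z) intrD.
  rewrite -[N%:Z%:~R]/(N%:R : R); move: ((height a)%:~R : R) => t.
  by apply/idP/idP; lra.
pose pA a : induced A := exist (fun x => x \in A) (real_point N a) (Aa a).
pose B := [set x : induced A | `|coord_sum (val x)| <= N%:R / 2]%classic.
have slabP (a : layer N) : pA (pos a) \in B.
  by apply: mem_set; rewrite /B /= heightP posP.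
pose F (a : layer N) : slab A (N%:R / 2) :=
  exist (fun x => x \in B) _ (slabP a).
apply: (@graph_isoP (layer N) _ F) => [a b|x|a b].
- move=> /(congr1 (fun x => val (val x))) /= /rowP ab; apply: pos_inj.
  have {}ab i := intr_inj
    (addIr _ (etrans (esym (mxE _ _ _ _)) (etrans (ab i) (mxE _ _ _ _)))).
  apply: triple_eq.
  + exact: (ab 0).
  + exact: (ab 1).
  + exact: (ab 2).
- have /AP xint := set_mem (valP (val x)).
  pose y : 'rV[R]_3 := val (val x).
  pose c i := Num.floor (y 0 i + N%:R / 2).
  have yE : real_point N (c 0, c 1, c 2) = y.
    apply/rowP => i; rewrite mxE (tnth_nth 0).
    have -> : nth 0 [tuple c 0; c 1; c 2] i = c i.
      by case: i => [[|[|[|]]] hi] //=; congr c; apply: val_inj.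
    by rewrite /c floorK ?addrK.
  have h : N%:Z <= height (c 0, c 1, c 2) <= N%:Z *+ 2.
    by rewrite -heightP yE; exact: (set_mem (valP x)).
  by exists (at_pos h); apply: val_inj; apply: val_inj; rewrite /= yE.
- apply: iff_trans (iff_sym (king_adj_real_point N (pos a) (pos b))).
  split=> -[ab cab]; split=> // eab; apply: ab; first exact: pos_inj.
  by rewrite eab.
Qed.

Lemma G3_slab_layer n : G3_slab (n%:R : R) ≅ layer n.*2.
Proof.
have e : n%:R = n.*2%:R / 2 :> R by rewrite -muln2 natrM; lra.
rewrite e; apply: slab_layer => x.
by split=> xint i; move: (xint i); rewrite /= -e addrC rpredDl // intr_nat.
Qed.

Lemma G3star_slab_layer n : G3star_slab (n%:R + 2^-1 : R) ≅ layer n.*2.+1.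
Proof.
have e : n%:R + 2^-1 = n.*2.+1%:R / 2 :> R.
  by rewrite -[n.*2.+1]addn1 natrD -muln2 natrM; lra.
rewrite e; apply: slab_layer => x.
have shift i : x 0 i + n.*2.+1%:R / 2 = n.+1%:R + (x 0 i - 2^-1).
  by rewrite -e -[n.+1]addn1 natrD; lra.
by split=> xint i; move: (xint i); rewrite /= shift (rpredDl _ (natr_int R n.+1)).
Qed.

End RealSlab.

(** * Iteration, and return to the slabs *)

Lemma iter_clique_graph_iso n (G H : graph) :
  G ≅ H -> iter_clique_graph n G ≅ iter_clique_graph n H.
Proof. by move=> GH; elim: n => //= n; exact: clique_graph_iso. Qed.

Lemma iter_clique_graph_layer n N :
  iter_clique_graph n (layer N) ≅ layer (n + N).
Proof.
elim: n => [|n IHn]; first by exists id; split=> //; exists id.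
exact: graph_iso_trans (clique_graph_iso IHn) (clique_graph_layer _).
Qed.

Theorem theorem1 (R : realType) :
  (forall n : nat,
     clique_graph (G3_slab (n%:R : R)) ≅ G3star_slab (n%:R + 2^-1 : R))
  /\
  (forall r : R, (exists m : nat, r = m%:R + 2^-1) ->
     clique_graph (G3star_slab r) ≅ G3_slab (r + 2^-1))
  /\
  (forall n : nat,
     iter_clique_graph 2 (G3_slab (n%:R : R)) ≅ G3_slab (n%:R + 1 : R))
  /\
  (forall n : nat,
     (~~ odd n -> iter_clique_graph n (Hex R) ≅ G3_slab (n%:R / 2 : R)) /\
     (odd n -> iter_clique_graph n (Hex R) ≅ G3star_slab (n%:R / 2 : R))).
Proof.
(* Each claim reduces to counting: [m] clique graphs raise the layer index, twice the slab bound, by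
   [m]. *)
have iterP m N (G H : graph) :
    G ≅ layer N -> H ≅ layer (m + N) -> iter_clique_graph m G ≅ H.
  move=> GN HN; apply: graph_iso_trans (iter_clique_graph_iso m GN) _.
  exact: graph_iso_trans (iter_clique_graph_layer m N) (graph_iso_sym HN).
split=> [n|].
  exact: (iterP 1%N _ _ _ (G3_slab_layer R n) (G3star_slab_layer R n)).
split=> [_ [m ->]|].
  have -> : m%:R + 2^-1 + 2^-1 = m.+1%:R :> R by rewrite -[m.+1]addn1 natrD; lra.
  exact: (iterP 1%N _ _ _ (G3star_slab_layer R m) (G3_slab_layer R m.+1)).
split=> n.
  rewrite natr1.
  exact: (iterP 2%N _ _ _ (G3_slab_layer R n) (G3_slab_layer R n.+1)).
split=> n_odd; apply: (iterP n _ _ _ (G3_slab_layer R 0)); rewrite addn0.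
- have nE : n = n./2.*2 by rewrite even_halfK.
  have -> : n%:R / 2 = n./2%:R :> R by rewrite {1}nE -muln2 natrM; lra.
  by rewrite {2}nE; exact: G3_slab_layer.
- have nE : n = n./2.*2.+1 by rewrite odd_halfK // prednK // odd_gt0.
  have -> : n%:R / 2 = n./2%:R + 2^-1 :> R.
    by rewrite {1}nE -[n./2.*2.+1]addn1 natrD -muln2 natrM; lra.
  by rewrite {2}nE; exact: G3star_slab_layer.
Qed.
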